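(* For every constant $\epsilon>0$ there is $\beta_0=\beta_0(\epsilon)$ such that for all $\beta\ge\beta_0$ the utilitarian distortion of the Copeland rule under the Plackett–Luce model with parameter $\beta$ is at least $(1-\epsilon)\beta$, i.e. $$\sup_{m\ge 2}\ \mathcal{D}_{m,\beta}(\mathrm{Copeland})\;\ge\;(1-\epsilon)\,\beta .$$
   Context: Setting. $C$ is a set of $m$ candidates and $\beta\ge 1$ is a real parameter. Let $\mathcal{V}$ be a probability distribution on $[0,1]^C$ (utility vectors). For each $n$, the utility vectors $\mathbf{u}_1,\dots,\mathbf{u}_n$ of $n$ voters are drawn i.i.d. from $\mathcal{V}$, with $u_{i,j}\in[0,1]$ the utility of voter $i$ for candidate $j$. Given the utilities, each voter $i$ independently submits a random ranking $\pi_i$ of $C$ drawn from the Plackett–Luce model: positions are filled from top to bottom, and at each step a candidate $j$ is chosen among the not yet ranked candidates with probability proportional to $e^{\beta u_{i,j}}$. A voting rule $f$ maps each profile $\pi^n=(\pi_1,\dots,\pi_n)$ (for every $n$) to a probability distribution over $C$; it is deterministic if it always selects a single winner. Put $\mathrm{Util}_j=\mathbb{E}_{\mathbf{u}\sim\mathcal{V}}[u_j]$ and $\mathrm{Util}_n(f)=\mathbb{E}\big[\tfrac1n\sum_{i=1}^n u_{i,f(\pi^n)}\big]$, the expectation being over utilities, rankings and any internal randomness of $f$. The utilitarian distortion (with $m$ candidates) is $$\mathcal{D}_{m,\beta}(f)=\sup_{\mathcal{V}}\ \limsup_{n\to\infty}\ \frac{\max_{j\in C}\mathrm{Util}_j}{\mathrm{Util}_n(f)},$$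 with the ratio taken to be $1$ if numerator and denominator are both $0$. Copeland rule. Fix a strict ordering $\triangleright$ of the candidates for tie-breaking. Let $s_{j,j'}$ be the fraction of voters ranking $j$ above $j'$. The Copeland score of $j$ is $\sum_{j'\ne j}\big[\mathbb{1}(s_{j,j'}>\tfrac12)+\mathbb{1}(s_{j,j'}=\tfrac12\text{ and }j\triangleright j')\big]$. The rule selects a candidate of maximum Copeland score, ties in the score being broken by $\triangleright$. *)

(* Defs.v *)
From HB Require Import structures.
From mathcomp Require Import all_boot all_order all_algebra all_fingroup.
From mathcomp Require Import all_classical all_reals all_analysis.

Set Implicit Arguments.
Unset Strict Implicit.
Unset Printing Implicit Defensive.

Import Order.TTheory GRing.Theory Num.Theory.
Import numFieldNormedType.Exports.

Local Open Scope classical_set_scope.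
Local Open Scope ring_scope.

(* The candidates are the elements of 'I_m. *)

Section product_probability.
Context d1 d2 (T1 : measurableType d1) (T2 : measurableType d2) (R : realType).
Variables (P : probability T1 R) (Q : probability T2 R).

Definition product_prob : set (T1 * T2) -> \bar R := (P \x Q)%E.

HB.instance Definition _ := Measure.on product_prob.

Let product_prob_setT : product_prob setT = 1%E.
Proof.
rewrite /product_prob -setXTT product_measure1E//.
by apply: etrans (mule1 _); congr (_ * _)%E; exact: probability_setT.
Qed.

HB.instance Definition _ :=
  Measure_isProbability.Build _ _ _ product_prob product_prob_setT.

End product_probability.

Section iid.
Context d (T : measurableType d) (R : realType).

Definition tuple_cons n (x : T * n.-tuple T) : n.+1.-tuple T :=
  [tuple of x.1 :: x.2].

Lemma measurable_tuple_cons n : measurable_fun setT (@tuple_cons n).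
Proof. exact: measurable_cons. Qed.

HB.instance Definition _ n :=
  isMeasurableFun.Build _ _ _ _ (@tuple_cons n) (@measurable_tuple_cons n).

(* The n-fold product measure P ^ n, i.e. the joint law of n independent
   draws from P. *)
Fixpoint iid (P : probability T R) n : probability (n.-tuple T) R :=
  match n with
  | 0 => \d_([tuple] : 0.-tuple T)
  | k.+1 => distribution (product_prob P (iid P k)) (@tuple_cons k)
  end.

End iid.

Section plackett_luce.
Variables (R : realType) (m : nat).

(* A ranking s : 'S_m maps a position (0 is the top) to the candidate put
   there. *)
Definition ranked_above (s : 'S_m) (j j' : 'I_m) : bool :=
  ((s^-1)%g j < (s^-1)%g j')%N.

(* Probability of the ranking s for the utilities u: at position k the
   candidates not yet ranked are the s l with k <= l. *)
Definition PL_prob (beta : R) (u : 'I_m -> R) (s : 'S_m) : R :=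
  \prod_(k < m) (expR (beta * u (s k)) /
                 \sum_(l < m | (k <= l)%N) expR (beta * u (s l))).

End plackett_luce.

Definition profile (m n : nat) := {ffun 'I_n -> 'S_m}.

Record lottery (R : realType) (m : nat) := Lottery {
  lottery_weight :> 'I_m -> R;
  lottery_ge0 : forall j, 0 <= lottery_weight j;
  lottery_sum1 : \sum_j lottery_weight j = 1 }.

Definition voting_rule (R : realType) (m : nat) :=
  forall n, profile m n -> lottery R m.

Section deterministic.
Variables (R : realType) (m : nat).

Lemma point_ge0 (c j : 'I_m) : 0 <= (j == c)%:R :> R.
Proof. exact: ler0n. Qed.

Lemma point_sum1 (c : 'I_m) : \sum_j (j == c)%:R = 1 :> R.
Proof.
by rewrite (bigD1 c)//= eqxx big1 ?addr0// => j /negbTE ->.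
Qed.

Definition point_lottery (c : 'I_m) : lottery R m :=
  Lottery (point_ge0 c) (point_sum1 c).

Definition deterministic_rule (w : forall n, profile m n -> 'I_m) :
  voting_rule R m := fun n p => point_lottery (w n p).

End deterministic.

Section distortion.
Variables (R : realType) (m : nat) (beta : R).

(* Distributions on [0, 1]^C, as Borel probabilities on R^C carried by the
   cube. *)
Definition utility_distributions : set (probability (m.-tuple R) R) :=
  [set V | V [set u | forall j : 'I_m, 0 <= tnth u j <= 1] = 1%E].

Definition Util (V : probability (m.-tuple R) R) (j : 'I_m) : \bar R :=
  'E_V[fun u => tnth u j].

(* Given the utilities, the rankings (and the lottery of f) have finite range,
   so that their expectation is the finite sum inside 'E. *)
Definition Util_rule (V : probability (m.-tuple R) R) (f : voting_rule R m)
    (n : nat) : \bar R :=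
  'E_(iid V n)[fun u : n.-tuple (m.-tuple R) =>
    \sum_(p : profile m n)
      (\prod_(i < n) PL_prob beta (tnth (tnth u i)) (p i)) *
      \sum_(j < m) f n p j * (n%:R^-1 * \sum_(i < n) tnth (tnth u i) j)].

(* Here x / 0 = +oo for 0 < x. *)
Definition util_ratio (x y : \bar R) : \bar R :=
  if (x == 0%E) && (y == 0%E) then 1%E else (x / y)%E.

Definition distortion (f : voting_rule R m) : \bar R :=
  ereal_sup [set limn_esup (fun n =>
      util_ratio (\big[maxe/-oo%E]_(j < m) Util V j) (Util_rule V f n))
    | V in utility_distributions].

End distortion.

Record tiebreak (m : nat) := Tiebreak {
  tb_rel :> rel 'I_m;
  tb_irr : irreflexive tb_rel;
  tb_trans : transitive tb_rel;
  tb_total : forall j j', j != j' -> tb_rel j j' || tb_rel j' j }.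

Section copeland.
Variables (m : nat) (tb : tiebreak m.+1) (n : nat) (p : profile m.+1 n).
Implicit Types j : 'I_m.+1.

Definition pairwise_share j j' : rat :=
  #|[pred i : 'I_n | ranked_above (p i) j j']|%:R / n%:R.

Definition copeland_score j : nat :=
  (\sum_(j' < m.+1 | j' != j)
     ((pairwise_share j j' > 2^-1)%R +
      ((pairwise_share j j' == 2^-1)%R && tb j j')))%N.

Definition copeland_better j j' : bool :=
  (copeland_score j' < copeland_score j)%N ||
  ((copeland_score j == copeland_score j') && tb j j').

Definition copeland_best j : bool :=
  [forall j', (j' != j) ==> copeland_better j j'].

(* The default value is never used, by copeland_winner_best. *)
Definition copeland_winner : 'I_m.+1 := odflt ord0 [pick j | copeland_best j].

Lemma copeland_better_trans : transitive copeland_better.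
Proof.
move=> y x z /orP[xy|/andP[/eqP xy txy]] /orP[yz|/andP[/eqP yz tyz]];
  apply/orP.
- by left; exact: ltn_trans yz xy.
- by left; rewrite -yz.
- by left; rewrite xy.
- by right; rewrite xy yz eqxx (tb_trans txy tyz).
Qed.

Lemma copeland_better_total j j' :
  j != j' -> copeland_better j j' || copeland_better j' j.
Proof.
move=> /(tb_total tb) jj'; rewrite /copeland_better.
by case: ltngtP => //=.
Qed.

Lemma copeland_winner_best : copeland_best copeland_winner.
Proof.
rewrite /copeland_winner; case: pickP => //= nobest.
pose N j := #|[pred j' | copeland_better j j']|.
have [j _ jmax] := @arg_maxnP _ ord0 xpredT N isT.
have /negbT := nobest j; rewrite negb_forall => /existsP[j'].
rewrite negb_imply => /andP[j'j /negbTE njj'].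
have j'_better : copeland_better j' j.
  by have := copeland_better_total j'j; rewrite njj' orbF.
have irr x : copeland_better x x = false.
  by rewrite /copeland_better ltnn tb_irr andbF.
have /= := jmax j' isT; rewrite leqNgt => /negP[]; apply: proper_card.
apply/properP; split.
  by apply/fintype.subsetP => x; rewrite !inE; exact: copeland_better_trans.
by exists j; rewrite !inE// irr.
Qed.

End copeland.

Definition copeland (R : realType) (m : nat) (tb : tiebreak m.+1) :
    voting_rule R m.+1 :=
  deterministic_rule R (copeland_winner tb).

(* Main.v *)
Require Import Defs.
From HB Require Import structures.
From mathcomp Require Import all_boot all_order all_algebra all_fingroup.
From mathcomp Require Import all_classical all_reals all_analysis.
From mathcomp Require Import measurable_realfun ring lra.

(* Three candidates suffice. Let a be the one favoured by the tie-breaking, b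
   the best one, c the third. With a small p, take three types of voters with
   utilities for (a, c, b):
     (0, 0, 1) with mass (1 - e) p,   (0, 1, 1 - e) with mass p,
     (t / beta, 0, 0) otherwise, where t is about 2 p.
   The first type costs c about p / 2 against b, which the second type makes
   up for: for large beta it ranks c above b almost surely although both
   utilities are near 1. The second type costs a about p / 2 against c, and the
   third one makes up for it, since a gap t / beta already shifts the
   probability by about t / 4. So a beats c and c beats b with strict majorities
   in expectation, hence with probability tending to 1; whatever happens between
   a and b, the candidate a then wins, possibly by tie-breaking. The utility of b
   is about 2 p and that of a about 2 p / beta. *)

Set Implicit Arguments.
Unset Strict Implicit.
Unset Printing Implicit Defensive.

Import Order.TTheory GRing.Theory Num.Theory.
Import numFieldNormedType.Exports.

Local Open Scope classical_set_scope.
Local Open Scope ring_scope.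

(** * Marginals of the Plackett-Luce model *)

(** A ranking amounts to its top candidate [i] and a ranking of the others, relabelled by skipping
    [i]; this drives the inductions on the number of candidates. *)
Lemma sum_lift_perm (V : nmodType) m (F : 'S_m.+1 -> V) :
  \sum_s F s = \sum_i \sum_s F (lift_perm ord0 i s).
Proof.
rewrite (partition_big (fun s : 'S_m.+1 => s ord0) predT)//=.
apply: eq_bigr => i _; rewrite (reindex (lift_perm ord0 i)); last first.
  (* Inverse map: drop position 0 and close the gap left by its candidate. Injectivity of [s] makes
     the default [k] unreachable. *)
  pose unlift_fun (s : 'S_m.+1) k := odflt k (unlift (s ord0) (s (lift ord0 k))).
  have unlift_funE (s : 'S_m.+1) k :
      lift (s ord0) (unlift_fun s k) = s (lift ord0 k).
    rewrite /unlift_fun; have [j /=|/perm_inj/eqP] := unliftP; first by [].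
    by rewrite eq_sym (negbTE (neq_lift _ _)).
  have unlift_inj s : injective (unlift_fun s).
    move=> k l /(congr1 (lift (s ord0))); rewrite !unlift_funE.
    by move/perm_inj/lift_inj.
  exists (fun s => perm (@unlift_inj s)) => [s _|s /eqP s0].
    apply/permP => k.
    by rewrite permE /unlift_fun lift_perm_lift lift_perm_id liftK.
  apply/permP => k; case: (unliftP ord0 k) => [l|] ->; rewrite ?lift_perm_id//.
  by rewrite lift_perm_lift -s0 permE unlift_funE.
by apply: eq_bigl => s; rewrite lift_perm_id eqxx.
Qed.

Section plackett_luce.
Variables (R : realType) (beta : R).

(** Once the top is filled, the remaining choices follow the same model on the remaining
    candidates. *)
Lemma PL_prob_lift_perm m (u : 'I_m.+1 -> R) i s :
  PL_prob beta u (lift_perm ord0 i s) =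
  expR (beta * u i) / (\sum_j expR (beta * u j)) *
  PL_prob beta (u \o lift i) s.
Proof.
rewrite /PL_prob big_ord_recl lift_perm_id; congr (_ / _ * _).
  by rewrite [RHS](reindex_inj (@perm_inj _ (lift_perm ord0 i s))).
apply: eq_bigr => k _; rewrite lift_perm_lift; congr (_ / _).
(* Position 0 drops out of the later denominators; the other positions shift by one. *)
rewrite big_mkcond big_ord_recl /= add0r [RHS]big_mkcond /=.
by apply: eq_bigr => l _; rewrite lift_perm_lift.
Qed.

Lemma PL_prob_ge0 m (u : 'I_m -> R) s : 0 <= PL_prob beta u s.
Proof.
apply: prodr_ge0 => k _; apply: divr_ge0; first exact: expR_ge0.
by apply: sumr_ge0 => l _; exact: expR_ge0.
Qed.

Lemma sum_expR_gt0 m (u : 'I_m.+1 -> R) : 0 < \sum_j expR (beta * u j).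
Proof.
rewrite big_ord_recl ltr_wpDr ?expR_gt0//.
by apply: sumr_ge0 => l _; exact: expR_ge0.
Qed.

Lemma PL_prob_sum1 m (u : 'I_m -> R) : \sum_s PL_prob beta u s = 1.
Proof.
elim: m u => [|m IHm] u.
  rewrite (bigD1 1%g)//= [X in _ + X]big1 ?addr0 ?/PL_prob ?big_ord0//.
  by move=> s /eqP[]; apply/permP; case.
rewrite sum_lift_perm.
under eq_bigr => i _.
  under eq_bigr => s _ do rewrite PL_prob_lift_perm.
  rewrite -mulr_sumr IHm mulr1; over.
by rewrite -mulr_suml divff// gt_eqF// sum_expR_gt0.
Qed.

Lemma ranked_above_lift_perm m (i j j' : 'I_m.+1) s :
  ranked_above (lift_perm ord0 i s) j j' =
  match unlift i j, unlift i j' with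
  | Some k, Some k' => ranked_above s k k'
  | None, Some _ => true
  | _, None => false
  end.
Proof.
rewrite /ranked_above lift_permV.
case: (unliftP i j) => [k|] ->; case: (unliftP i j') => [k'|] ->;
  by rewrite ?lift_perm_id ?lift_perm_lift.
Qed.

(** Condition on the top candidate: [j] decides for, [j'] against, and any other leaves by induction
    the same ratio r. With weights E and total S, the sum is (E j + (S - E j - E j') r) / S = r. *)
Lemma PL_prob_ranked_above m (u : 'I_m -> R) j j' : j != j' ->
  \sum_(s | ranked_above s j j') PL_prob beta u s =
  expR (beta * u j) / (expR (beta * u j) + expR (beta * u j')).
Proof.
elim: m u j j' => [u []//|m IHm] u j j' jj'.
set E := fun i => expR (beta * u i).
have E0 i : 0 < E i by exact: expR_gt0.
have S0 : 0 < \sum_i E i by exact: sum_expR_gt0.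
set S := \sum_i E i in S0 *.
rewrite big_mkcond sum_lift_perm.
under eq_bigr => i _.
  under eq_bigr => s _ do
    rewrite PL_prob_lift_perm ranked_above_lift_perm -/S -/(E i).
  over.
rewrite /= (bigD1 j)//= (bigD1 j') /=; last by rewrite eq_sym.
rewrite unlift_none; case: (unliftP j j') => [k'|/eqP]; last first.
  by rewrite eq_sym (negbTE jj').
move=> _; rewrite -mulr_sumr PL_prob_sum1 mulr1 unlift_none.
rewrite [X in _ + (X + _)]big1 ?add0r; last by move=> s _; case: unlift.
rewrite (eq_bigr (fun i => E i * (E j / (E j + E j') / S))); last first.
  move=> i /andP[ij ij'].
  case: (unliftP i j) => [k jk|/eqP]; last by rewrite eq_sym (negbTE ij).
  case: (unliftP i j') => [l jl|/eqP]; last by rewrite eq_sym (negbTE ij').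
  rewrite -big_mkcond -mulr_sumr IHm; last first.
    by apply: contraNneq jj'; rewrite jk jl => ->.
  by rewrite /= -jk -jl -/(E j) -/(E j'); ring.
rewrite -mulr_suml.
have SE : S = E j + (E j' + \sum_(i | (i != j) && (i != j')) E i).
  by rewrite [LHS](bigD1 j)//= [in LHS](bigD1 j') 1?eq_sym.
have -> : \sum_(i | (i != j) && (i != j')) E i = S - E j - E j'.
  by rewrite SE; ring.
rewrite -/(E j) -/(E j').
by field; rewrite !gt_eqF // addr_gt0.
Qed.

End plackett_luce.

(** * Pairwise majorities *)

(** Take [a] preceding the most candidates: anything preceding [a] would by transitivity precede
    strictly more. *)
Lemma tiebreak_top m (tb : tiebreak m.+1) :
  exists a, forall j, j != a -> tb a j.
Proof.
pose N j := #|[pred j' | tb j j']|.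
have [a _ amax] := @arg_maxnP _ ord0 xpredT N isT.
exists a => j ja; have := tb_total tb ja; case/orP => // tja.
have /= := amax j isT; rewrite leqNgt => /negP[]; apply: proper_card.
apply/properP; split.
  by apply/fintype.subsetP => x; rewrite !inE => /(tb_trans tja).
by exists a; rewrite !inE // tb_irr.
Qed.

Section copeland.
Variables (m : nat) (tb : tiebreak m.+1) (n : nat) (p : profile m.+1 n).
Implicit Types j : 'I_m.+1.

Lemma pairwise_share_asym j j' :
  2^-1 < pairwise_share p j j' -> pairwise_share p j' j < 2^-1.
Proof.
move=> jj'; rewrite ltNge; apply/negP => j'j.
have : 1 < pairwise_share p j j' + pairwise_share p j' j by lra.
(* The two groups of voters are disjoint. Without voters both shares are 0 / 0 = 0. *)
rewrite -mulrDl -natrD; case: n p jj' {j'j} => [p0|n' p'] _.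
  by rewrite invr0 mulr0 ltNge ler01.
rewrite ltr_pdivlMr ?ltr0n// mul1r ltr_nat ltnNge -[leqRHS]card_ord -cardUI.
rewrite [X in (_ + X)%N]eq_card0 ?addn0 ?max_card// => i; rewrite !inE.
by rewrite /ranked_above; case: ltngtP.
Qed.

Lemma copeland_score_gt0 j j' : j' != j ->
  2^-1 < pairwise_share p j j' -> (0 < copeland_score tb p j)%N.
Proof. by move=> j'j jj'; rewrite /copeland_score (bigD1 j')//= jj'. Qed.

Lemma copeland_score_lt j j' : j' != j ->
  2^-1 < pairwise_share p j' j -> (copeland_score tb p j < m)%N.
Proof.
move=> j'j /pairwise_share_asym jj'.
have mE : (\sum_(k < m.+1 | k != j) 1)%N = m.
  by rewrite sum1_card (eq_card (B := predC1 j)) // cardC1 card_ord.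
rewrite -[ltnRHS]mE /copeland_score (bigD1 j')//= [leqRHS](bigD1 j')//=.
rewrite ltNge (ltW jj') lt_eqF//= add0n add1n ltnS.
apply: leq_sum => k _; by case: ltgtP => //= _; case: (tb _ _).
Qed.

End copeland.

(** Beating [c] gives [a] at least one point, while [b] and [c] each lose a comparison and have at
    most one of two. So [a] has maximal score and wins any tie. *)
Lemma copeland_winner_cycle (tb : tiebreak 3) n (p : profile 3 n) a b c :
  (forall j, j != a -> tb a j) -> (forall j, [|| j == a, j == b | j == c]) ->
  c != a -> b != c ->
  2^-1 < pairwise_share p a c -> 2^-1 < pairwise_share p c b ->
  copeland_winner tb p = a.
Proof.
move=> atop abc ca bc ac cb; set w := copeland_winner tb p.
apply/eqP; apply: contraT => wa.
have := @forallP _ _ (copeland_winner_best tb p) a.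
rewrite -/w eq_sym wa /= /copeland_better.
have -> : tb w a = false.
  by apply/negP => /(tb_trans (atop _ wa)); rewrite tb_irr.
rewrite andbF orbF; have a0 := copeland_score_gt0 tb ca ac.
move=> /(leq_ltn_trans a0); rewrite ltnNge -ltnS => /negP[].
have /orP[/eqP->|/eqP->] : (w == b) || (w == c).
- by have := abc w; rewrite (negbTE wa).
- by apply: copeland_score_lt cb; rewrite eq_sym.
- by apply: copeland_score_lt ac; rewrite eq_sym.
Qed.

(** * Chernoff bounds for the pairwise majorities *)

Section concentration.
Variables (R : realType) (m n : nat) (beta : R).

(* Chernoff weights: their product over the voters is at least 1 unless j beats
   j' strictly, and its expectation factors. *)
Definition tilt (theta : R) (j j' : 'I_m.+1) (s : 'S_m.+1) : R :=
  if ranked_above s j j' then theta^-1 else theta.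

Definition PL_tilt (theta : R) (j j' : 'I_m.+1) (v : 'I_m.+1 -> R) : R :=
  \sum_s PL_prob beta v s * tilt theta j j' s.

Lemma tilt_ge0 theta j j' s : 0 <= theta -> 0 <= tilt theta j j' s.
Proof. by move=> ?; rewrite /tilt; case: ifP; rewrite ?invr_ge0. Qed.

Lemma PL_tiltE theta j j' v : j != j' ->
  PL_tilt theta j j' v = theta - (theta - theta^-1) *
    (expR (beta * v j) / (expR (beta * v j) + expR (beta * v j'))).
Proof.
move=> jj'; rewrite -PL_prob_ranked_above// big_mkcond mulr_sumr /=.
rewrite -[X in X - _]mul1r -(PL_prob_sum1 beta v) mulr_suml -sumrB.
by apply: eq_bigr => s _; rewrite /tilt; case: ifP => _; ring.
Qed.

(** The product is [theta] to the number of voters against [j] minus the number for [j]. *)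
Lemma prod_tilt_ge1 theta j j' (p : profile m.+1 n) : 1 <= theta ->
  pairwise_share p j j' <= 2^-1 -> 1 <= \prod_(i < n) tilt theta j j' (p i).
Proof.
move=> theta1 share.
have theta0 : 0 < theta by lra.
rewrite /tilt (bigID [pred i | ranked_above (p i) j j']) /=.
under eq_bigr => i -> do over.
under [X in _ * X]eq_bigr => i /negbTE -> do over.
rewrite !prodr_const exprVn mulrC ler_pdivlMr ?exprn_gt0// mul1r.
apply: ler_weXn2l => //.
rewrite -(leq_add2r #|[pred i | ranked_above (p i) j j']|).
have -> : (#|[pred i | ~~ ranked_above (p i) j j']| +
    #|[pred i | ranked_above (p i) j j']| = n)%N.
  by rewrite addnC -[RHS]card_ord -(cardC [pred i | ranked_above (p i) j j']).
move: share; rewrite /pairwise_share addnn -muln2.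
case: n p => [p0 _|n' p']; first by rewrite eq_card0// => -[].
by rewrite ler_pdivrMr ?ltr0n// mulrC ler_pdivlMr ?ltr0n// -natrM ler_nat.
Qed.

(** Profile by profile: either both majorities are strict and [a] wins, or one of the two tilt
    products is at least 1, hence at least the average utility of the winner. *)
Lemma expected_utility_le theta theta' (a b c : 'I_m.+1)
    (w : profile m.+1 n -> 'I_m.+1) (u : 'I_n -> 'I_m.+1 -> R) :
  1 <= theta -> 1 <= theta' -> (forall i j, 0 <= u i j <= 1) ->
  (forall p, 2^-1 < pairwise_share p a c -> 2^-1 < pairwise_share p c b ->
     w p = a) ->
  \sum_(p : profile m.+1 n) (\prod_(i < n) PL_prob beta (u i) (p i)) *
     \sum_(j < m.+1) point_lottery R (w p) j * (n%:R^-1 * \sum_(i < n) u i j)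
  <= n%:R^-1 * \sum_(i < n) u i a +
     (\prod_(i < n) PL_tilt theta a c (u i) +
      \prod_(i < n) PL_tilt theta' c b (u i)).
Proof.
move=> theta1 theta'1 u01 wa.
have avg0 j : 0 <= n%:R^-1 * \sum_(i < n) u i j.
  by rewrite mulr_ge0 ?invr_ge0// sumr_ge0// => i _; case/andP: (u01 i j).
have avg1 j : n%:R^-1 * \sum_(i < n) u i j <= 1.
  have [n0|n0] := eqVneq (n%:R : R) 0; first by rewrite n0 invr0 mul0r.
  rewrite ler_pdivrMl ?lt0r ?n0 ?ler0n// mulr1.
  have -> : n%:R = \sum_(i < n) 1 :> R by rewrite sumr_const card_ord.
  by apply: ler_sum => i _; case/andP: (u01 i j).
(* Given the utilities the voters are independent, so the expected product is the product of
   expectations. *)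
have prod_PL_tilt r j j' : \prod_(i < n) PL_tilt r j j' (u i) =
    \sum_(p : profile m.+1 n) (\prod_(i < n) PL_prob beta (u i) (p i)) *
       \prod_(i < n) tilt r j j' (p i).
  rewrite bigA_distr_bigA; apply: eq_bigr => p _; exact: big_split.
have sum1 : \sum_(p : profile m.+1 n) (\prod_(i < n) PL_prob beta (u i) (p i)) = 1.
  transitivity (\prod_(i < n) \sum_s PL_prob beta (u i) s).
    by rewrite bigA_distr_bigA.
  by rewrite big1// => i _; exact: PL_prob_sum1.
have sumE (r : R) :
    \sum_(p : profile m.+1 n) (\prod_(i < n) PL_prob beta (u i) (p i)) * r = r.
  by rewrite -mulr_suml sum1 mul1r.
rewrite -[X in _ <= X + _]sumE !prod_PL_tilt -!big_split /=.
apply: ler_sum => p _; rewrite -!mulrDr ler_wpM2l//.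
  by apply: prodr_ge0 => i _; exact: PL_prob_ge0.
rewrite (bigD1 (w p))//= eqxx mul1r [X in _ + X]big1 ?addr0; last first.
  by move=> j /negbTE ->; rewrite mul0r.
have tprod0 r j j' : 1 <= r -> 0 <= \prod_(i < n) tilt r j j' (p i).
  by move=> r1; apply: prodr_ge0 => i _; apply: tilt_ge0; lra.
have := tprod0 _ a c theta1; have := tprod0 _ c b theta'1.
have := avg0 a; have := avg1 (w p).
have [ac|/(prod_tilt_ge1 theta1)] := ltP 2^-1 (pairwise_share p a c);
  last by lra.
have [cb|/(prod_tilt_ge1 theta'1)] := ltP 2^-1 (pairwise_share p c b);
  last by lra.
by rewrite wa//; lra.
Qed.

End concentration.

(** * Finitely supported distributions *)

(** Split [g] into positive and negative parts; additivity of [L] applied to g + g^- = g^+ then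
    gives the value at [g]. *)
Lemma expectation_ge0_additive d (T : measurableType d) (R : realType)
    (P : probability T R) (L : (T -> R) -> R) :
  (forall g : T -> R, measurable_fun setT g -> (forall t, 0 <= g t) ->
     (\int[P]_t (g t)%:E = (L g)%:E)%E) ->
  (forall g h : T -> R, L (g \+ h) = L g + L h) ->
  forall g : T -> R, measurable_fun setT g -> ('E_P[g] = (L g)%:E)%E.
Proof.
move=> PL LD g mg; rewrite unlock integralE.
rewrite (eq_integral (fun t => ((g^\+)%R t)%:E)); last first.
  by move=> t _; rewrite funeposE /funrpos EFin_max.
rewrite [X in (_ - X)%E](eq_integral (fun t => ((g^\-)%R t)%:E)); last first.
  by move=> t _; rewrite funenegE /funrneg EFin_max EFinN.
rewrite !PL//; last 2 first.
- exact: measurable_funrneg.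
- exact: measurable_funrpos.
rewrite -EFinB; congr EFin; apply/eqP; rewrite subr_eq -LD; apply/eqP.
congr L; apply/funext => t /=.
rewrite /funrpos /funrneg /Num.max oppr_lt0.
by have [||->] := ltgtP (g t) 0; rewrite ?oppr0 ?addr0 ?subrr.
Qed.

Section mixture.
Context d (T : measurableType d) (R : realType) (K : nat).
Variables (w : lottery R K.+1) (x : 'I_K.+1 -> T).

(* msum ranges over nat; only the k < K.+1 are used, where inord k is k. *)
Definition mixture : set T -> \bar R :=
  msum (fun k => mscale (NngNum (lottery_ge0 w (inord k))) \d_(x (inord k))) K.+1.

HB.instance Definition _ := Measure.on mixture.

Lemma mixture_setT : mixture setT = 1%E.
Proof.
rewrite /mixture /msum -[RHS]/(1%:E) -(lottery_sum1 w) -sumEFin.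
apply: eq_bigr => k _; rewrite -[RHS]mule1 -[k in RHS]inord_val.
by congr (_ * _)%E; exact: diracT.
Qed.

HB.instance Definition _ :=
  Measure_isProbability.Build _ _ _ mixture mixture_setT.

Lemma ge0_integral_mixture (f : T -> \bar R) :
  measurable_fun setT f -> (forall t, 0 <= f t)%E ->
  (\int[mixture]_t f t = \sum_(k < K.+1) (w k)%:E * f (x k))%E.
Proof.
move=> mf f0; rewrite ge0_integral_measure_sum//.
apply: eq_bigr => k _; rewrite ge0_integral_mscale//= integral_dirac//.
by rewrite diracT mul1e inord_val.
Qed.

(** The expectation over [n] draws as an iterated finite sum, following the recursion of [iid], so
    that its properties need only induction. *)
Fixpoint iid_mean n : (n.-tuple T -> R) -> R :=
  match n with
  | 0 => fun g => g [tuple]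
  | k.+1 => fun g =>
      \sum_(i < K.+1) w i * @iid_mean k (fun t => g (tuple_cons (x i, t)))
  end.

(** Tonelli separates the first draw from the others. *)
Lemma ge0_integral_iid n (g : n.-tuple T -> R) :
  measurable_fun setT g -> (forall t, 0 <= g t) ->
  (\int[iid mixture n]_t (g t)%:E = (iid_mean g)%:E)%E.
Proof.
elim: n g => [|n IHn] g mg g0.
  rewrite integral_dirac//; last exact/measurable_EFinP.
  by rewrite diracT mul1e.
have mgc : measurable_fun setT (fun y => g (tuple_cons y)).
  by apply: (measurableT_comp mg); exact: measurable_tuple_cons.
have mgcE : measurable_fun setT (fun y => (g (tuple_cons y))%:E).
  by apply: (measurableT_comp _ mgc).
rewrite ge0_integral_distribution//; last exact/measurable_EFinP.
rewrite /product_prob fubini_tonelli1 //; last by move=> y; rewrite lee_fin.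
rewrite ge0_integral_mixture; last 2 first.
- apply: measurable_fun_fubini_tonelli_F => // y.
  by rewrite lee_fin.
- by move=> t; apply: integral_ge0 => y _; rewrite lee_fin.
rewrite /= -sumEFin; apply: eq_bigr => i _.
rewrite EFinM /fubini_F /= IHn//.
exact: (measurable_fun_pair2 (x i) mgc).
Qed.

Lemma iid_meanD n (g h : n.-tuple T -> R) :
  iid_mean (g \+ h) = iid_mean g + iid_mean h.
Proof.
elim: n g h => [//|n IHn] g h /=.
rewrite -big_split/=; apply: eq_bigr => i _; rewrite -mulrDr; congr (_ * _).
exact: IHn.
Qed.

Lemma iid_meanZ n c (g : n.-tuple T -> R) :
  iid_mean (fun t => c * g t) = c * iid_mean g.
Proof.
elim: n g => [//|n IHn] g /=.
by rewrite mulr_sumr; apply: eq_bigr => i _; rewrite mulrCA -IHn.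
Qed.

Lemma iid_mean_cst n c : iid_mean (fun _ : n.-tuple T => c) = c.
Proof.
elim: n => [//|n IHn] /=.
by under eq_bigr do rewrite IHn; rewrite -mulr_suml lottery_sum1 mul1r.
Qed.

(** Comparing on tuples of support points is enough; only there are utilities known to lie in the
    unit interval. *)
Lemma ler_iid_mean n (g h : n.-tuple T -> R) :
  (forall t, (forall i, exists k, tnth t i = x k) -> g t <= h t) ->
  iid_mean g <= iid_mean h.
Proof.
elim: n g h => [|n IHn] g h gh /=; first by apply: gh => -[].
apply: ler_sum => k _; rewrite ler_wpM2l ?lottery_ge0//; apply: IHn => t tx.
apply: gh => i; case: (unliftP ord0 i) => [j|] ->.
  by rewrite tnthS.
by exists k.
Qed.

Lemma iid_mean_prod n (phi : T -> R) :
  iid_mean (fun t : n.-tuple T => \prod_(i < n) phi (tnth t i)) =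
  (\sum_k w k * phi (x k)) ^+ n.
Proof.
elim: n => [|n IHn] /=; first by rewrite big_ord0.
rewrite exprS mulr_suml; apply: eq_bigr => k _.
rewrite -IHn -mulrA -[X in _ = _ * X]iid_meanZ.
congr (_ * _); apply: (congr1 (@iid_mean n)); apply/funext => t.
rewrite big_ord_recl; congr (_ * _).
by apply: eq_bigr => i _; rewrite tnthS.
Qed.

Lemma iid_mean_sum n (f : T -> R) :
  iid_mean (fun t : n.-tuple T => \sum_(i < n) f (tnth t i)) =
  n%:R * \sum_k w k * f (x k).
Proof.
elim: n => [|n IHn] /=; first by rewrite big_ord0 mul0r.
rewrite -natr1 mulrDl mul1r -IHn addrC.
rewrite -[X in _ = _ + X]mul1r -(lottery_sum1 w) mulr_suml -big_split /=.
apply: eq_bigr => k _; rewrite -mulrDr; congr (_ * _).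
rewrite -[X in X + _](@iid_mean_cst n) -iid_meanD.
apply: (congr1 (@iid_mean n)); apply/funext => t /=.
rewrite big_ord_recl; congr (_ + _).
by apply: eq_bigr => i _; rewrite tnthS.
Qed.

Lemma expectation_iid n (g : n.-tuple T -> R) : measurable_fun setT g ->
  ('E_(iid mixture n)[g] = (iid_mean g)%:E)%E.
Proof.
apply: expectation_ge0_additive; [exact: ge0_integral_iid|exact: iid_meanD].
Qed.

Lemma expectation_mixture (g : T -> R) : measurable_fun setT g ->
  ('E_mixture[g] = (\sum_k w k * g (x k))%:E)%E.
Proof.
apply: (expectation_ge0_additive (L := fun g => \sum_k w k * g (x k))).
  move=> h mh h0; rewrite ge0_integral_mixture//; last exact/measurable_EFinP.
  by rewrite -sumEFin.
by move=> h h'; rewrite -big_split; apply: eq_bigr => k _; rewrite mulrDr.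
Qed.

End mixture.

(** * Distortion of the Copeland rule *)

Lemma limn_esup_ge (R : realType) (u : nat -> \bar R) (c : \bar R) N :
  (forall n, (N <= n)%N -> (c <= u n)%E) -> (c <= limn_esup u)%E.
Proof.
move=> cu; apply: le_ereal_inf_tmp => _ [A [M _ MA] <-].
apply: le_ereal_sup_tmp; exists (u (maxn M N)); last exact/cu/leq_maxr.
by exists (maxn M N) => //; apply: MA; exact: leq_maxl.
Qed.

(** The product form [c * y <= B] also covers [y = 0], where the ratio is infinite because [x] is
    positive. *)
Lemma util_ratio_ge (R : realType) (x : \bar R) (B c y : R) :
  0 < B -> (B%:E <= x)%E -> 0 <= y -> c * y <= B ->
  (c%:E <= util_ratio x y%:E)%E.
Proof.
move=> B0 Bx y0 cyB; rewrite /util_ratio.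
have x0 : (0 < x)%E by apply: lt_le_trans Bx; rewrite lte_fin.
rewrite gt_eqF//=; have [->|yN0] := eqVneq y 0.
  by rewrite inve0 gt0_muley// leey.
have y_gt0 : 0 < y by rewrite lt0r yN0.
rewrite inver (negbTE yN0) lee_pdivlMr// -EFinM.
by apply: le_trans Bx; rewrite lee_fin.
Qed.

(** * Measurability of the utility of a rule *)

Section measurability.
Variables (R : realType) (m : nat) (beta : R).

Lemma measurable_PL_prob s :
  measurable_fun setT (fun v : m.-tuple R => PL_prob beta (tnth v) s).
Proof.
have mexp k : measurable_fun setT (fun v : m.-tuple R => expR (beta * tnth v k)).
  apply: (measurableT_comp (@measurable_expR R)).
  by apply: measurable_funM => //; exact: measurable_tnth.
apply: measurable_prod => k _; apply: measurable_funM => //.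
(* The denominator is positive, since its sum contains the term [l = k]; its inverse is therefore
   exp (- ln). *)
rewrite [X in measurable_fun _ X](_ : _ = fun v : m.-tuple R => expR (- ln
    (\sum_(l < m) if (k <= l)%N then expR (beta * tnth v (s l)) else 0))).
  apply: (measurableT_comp (@measurable_expR R)).
  apply: (measurableT_comp (@oppr_measurable R setT)).
  apply: (measurableT_comp (@measurable_ln R)).
  by apply: measurable_sum => l; case: (k <= l)%N.
apply/funext => v; rewrite expRN big_mkcond lnK// posrE.
rewrite (bigD1 k)//= leqnn ltr_wpDr ?expR_gt0//.
by apply: sumr_ge0 => l _; case: ifP; rewrite ?expR_ge0.
Qed.

Lemma measurable_rule_utility n (f : voting_rule R m) :
  measurable_fun setT (fun u : n.-tuple (m.-tuple R) =>
    \sum_(p : profile m n)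
      (\prod_(i < n) PL_prob beta (tnth (tnth u i)) (p i)) *
      \sum_(j < m) f n p j * (n%:R^-1 * \sum_(i < n) tnth (tnth u i) j)).
Proof.
apply: measurable_sum => p; apply: measurable_funM.
  apply: measurable_prod => i _.
  exact: (measurableT_comp (measurable_PL_prob (p i)) (measurable_tnth i)).
apply: measurable_sum => j; apply: measurable_funM => //.
apply: measurable_funM => //; apply: measurable_sum => i.
exact: (measurableT_comp (measurable_tnth j) (measurable_tnth i)).
Qed.

End measurability.

Lemma mixture_utility_distribution (R : realType) m K (w : lottery R K.+1)
    (x : 'I_K.+1 -> m.-tuple R) :
  (forall k j, 0 <= tnth (x k) j <= 1) ->
  utility_distributions (mixture w x : probability (m.-tuple R) R).
Proof.
move=> x01; rewrite /utility_distributions /= -(mixture_setT w x).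
apply: eq_bigr => k _; congr (_ * _)%E.
by rewrite [LHS]diracE [RHS]diracE !mem_set.
Qed.

(** The choice [theta = 2 * q] gives 1 - 2 (q - 1/2)^2. It makes the expected weight per voter less
    than 1 as soon as the winning probability [q] exceeds one half. *)
Lemma tilt_contraction (R : realType) (q : R) : 2^-1 < q ->
  exists2 theta : R, 1 <= theta & theta - (theta - theta^-1) * q < 1.
Proof.
move=> q2; exists (2 * q); first by lra.
have -> : 2 * q - (2 * q - (2 * q)^-1) * q = 2 * q - 2 * q ^+ 2 + 2^-1.
  by field; lra.
by have : 0 < (q - 2^-1) ^+ 2; [apply: exprn_gt0; lra|nra].
Qed.

Lemma mean_PL_tilt (R : realType) m K (w : lottery R K.+1)
    (x : 'I_K.+1 -> 'I_m.+1 -> R) beta theta j j' : j != j' ->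
  \sum_k w k * PL_tilt beta theta j j' (x k) =
  theta - (theta - theta^-1) * \sum_k w k *
    (expR (beta * x k j) / (expR (beta * x k j) + expR (beta * x k j'))).
Proof.
move=> jj'; rewrite -[X in X - _]mul1r -(lottery_sum1 w) mulr_suml mulr_sumr.
by rewrite -sumrB; apply: eq_bigr => k _; rewrite PL_tiltE//; ring.
Qed.

(** * Copeland on a finitely supported distribution *)

Section copeland_mixture.
Variables (R : realType) (beta : R) (tb : tiebreak 3) (a b c : 'I_3).
Variables (K : nat) (w : lottery R K.+1) (x : 'I_K.+1 -> 3.-tuple R).
Hypothesis atop : forall j, j != a -> tb a j.
Hypothesis abc : forall j, [|| j == a, j == b | j == c].
Hypotheses (ca : c != a) (bc : b != c).
Hypothesis x01 : forall k j, 0 <= tnth (x k) j <= 1.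

Let V : probability (3.-tuple R) R := mixture w x.
Let mean j := \sum_k w k * tnth (x k) j.
(** The probability that a random voter, with both utilities and ranking random, puts [j] above
    [j']. *)
Let win j j' := \sum_k w k * (expR (beta * tnth (x k) j) /
  (expR (beta * tnth (x k) j) + expR (beta * tnth (x k) j'))).

(** The numbers [rho] are the mean tilts of the two comparisons; their powers bound what profiles
    without both strict majorities can add. *)
Lemma Util_rule_copeland_le : 2^-1 < win a c -> 2^-1 < win c b ->
  exists rho : R * R, [/\ 0 <= rho.1 < 1, 0 <= rho.2 < 1 &
    forall n, (0 < n)%N -> exists2 y : R,
      Util_rule beta V (copeland R tb) n = y%:E &
      0 <= y <= mean a + (rho.1 ^+ n + rho.2 ^+ n)].
Proof.
move=> /tilt_contraction[theta theta1 rho1] /tilt_contraction[theta' theta'1 rho2].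
pose r theta j j' := \sum_k w k * PL_tilt beta theta j j' (tnth (x k)).
have r_ge0 t j j' : 1 <= t -> 0 <= r t j j'.
  move=> t1; apply: sumr_ge0 => k _; rewrite mulr_ge0 ?lottery_ge0//.
  by apply: sumr_ge0 => s _; rewrite mulr_ge0 ?PL_prob_ge0 ?tilt_ge0; lra.
exists (r theta a c, r theta' c b); rewrite /= !r_ge0//=.
split; [by rewrite /r mean_PL_tilt 1?eq_sym|by rewrite /r mean_PL_tilt 1?eq_sym|].
move=> n n0; rewrite /Util_rule expectation_iid; last exact: measurable_rule_utility.
eexists; first by reflexivity.
apply/andP; split.
  rewrite -[leLHS](iid_mean_cst w x n); apply: ler_iid_mean => u ux.
  apply: sumr_ge0 => p _; apply: mulr_ge0.
    by apply: prodr_ge0 => i _; exact: PL_prob_ge0.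
  apply: sumr_ge0 => j _; rewrite !mulr_ge0 ?lottery_ge0 ?invr_ge0//.
  by apply: sumr_ge0 => i _; have [k ->] := ux i; case/andP: (x01 k j).
(* Write the powers as means of products over voters, so that both sides are [iid_mean]s and can be
   compared pointwise. *)
rewrite -(iid_mean_prod w x n (fun v => PL_tilt beta theta a c (tnth v))).
rewrite -(iid_mean_prod w x n (fun v => PL_tilt beta theta' c b (tnth v))).
rewrite -iid_meanD.
have -> : mean a = iid_mean w x (fun u : n.-tuple (3.-tuple R) =>
    n%:R^-1 * \sum_(i < n) tnth (tnth u i) a).
  rewrite iid_meanZ (iid_mean_sum w x n (fun v => tnth v a)) mulrA mulVf ?mul1r//.
  by rewrite pnatr_eq0 -lt0n.
rewrite -iid_meanD; apply: ler_iid_mean => u ux /=.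
apply: (@expected_utility_le _ _ _ beta theta theta' a b c _
  (fun i => tnth (tnth u i))) => //.
  by move=> i j; have [k ->] := ux i.
by move=> p; exact: copeland_winner_cycle.
Qed.

(** The upper bound on the rule's utility tends to [mean a], so the strict inequality persists for
    large [n]. *)
Lemma distortion_copeland_ge C : 2^-1 < win a c -> 2^-1 < win c b ->
  0 < mean b -> C * mean a < mean b ->
  (C%:E <= distortion beta (copeland R tb))%E.
Proof.
move=> ac cb B0 CAB.
have [[r1 r2] [/= r1_01 r2_01 rule]] := Util_rule_copeland_le ac cb.
(* Replacing [C] by its maximum with 0 allows multiplying inequalities by it; positivity of [mean b]
   keeps the strict bound. *)
have /(@cvgr_lt _ _ _ _ _ _) :
    (fun n => Num.max 0 C * (mean a + (r1 ^+ n + r2 ^+ n))) @ \oo -->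
    Num.max 0 C * (mean a + (0 + 0)).
  apply: cvgM; first exact: cvg_cst.
  apply: cvgD; first exact: cvg_cst.
  apply: cvgD; apply: cvg_expr; rewrite ger0_norm; lra.
have mb : Num.max 0 C * (mean a + (0 + 0)) < mean b.
  by rewrite !addr0 /Num.max; case: ifP => // _; rewrite mul0r.
move=> /(_ _ mb) [N _ HN].
apply: le_trans (_ : (limn_esup (fun n =>
      util_ratio (\big[maxe/-oo%E]_(j < 3) Util V j)
        (Util_rule beta V (copeland R tb) n)) <= _)%E).
  apply: (@limn_esup_ge _ _ _ (maxn N 1)) => n; rewrite geq_max => /andP[Nn n0].
  have [y -> /andP[y0 yle]] := rule n n0.
  apply: (@util_ratio_ge _ _ (mean b)) => //.
    have <- : Util V b = (mean b)%:E.
      by rewrite /Util expectation_mixture//; exact: measurable_tnth.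
    exact: le_bigmax.
  have /= := HN n Nn => /ltW; apply: le_trans.
  apply: (@le_trans _ _ (Num.max 0 C * y)).
    by rewrite ler_wpM2r// le_max lexx orbT.
  by rewrite ler_wpM2l// le_max lexx.
by apply: ereal_sup_ubound; exists V => //; exact: mixture_utility_distribution.
Qed.

End copeland_mixture.

(** * Estimates for the three types of voters *)

Lemma logistic_ge (R : realType) (t : R) : 0 <= t ->
  2^-1 + t / 2 / (2 + t) <= expR t / (expR t + 1).
Proof.
move=> t0; move: (expR_ge1Dx t); move: (expR t) => z zt.
have z0 : 0 < z by apply: lt_le_trans zt; rewrite ltr_pwDl.
(* The bound is the value at z = 1 + t, since (1 + t) / (2 + t) = 1/2 + t / (2 (2 + t)). *)
have -> : z / (z + 1) =
    2^-1 + t / 2 / (2 + t) + (z - (1 + t)) / ((2 + t) * (z + 1)).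
  by field; apply/andP; split; lra.
by rewrite lerDl divr_ge0 ?subr_ge0// mulr_ge0// addr_ge0// ltW.
Qed.

(** The probability is 1 - 1 / (exp (beta e) + 1), and exp (beta e) >= 1 + beta e. It is that of the
    second type ranking [c] above [b]. *)
Lemma logistic_gap_gt (R : realType) (e beta : R) : 0 < e -> 2 <= beta * e * e ->
  1 - e / 2 < expR beta / (expR beta + expR (beta * (1 - e))).
Proof.
move=> e0 be.
have -> : expR beta = expR (beta * (1 - e)) * expR (beta * e).
  by rewrite -expRD; congr expR; ring.
move: (expR_gt0 (beta * (1 - e))) (expR_gt0 (beta * e)) (expR_ge1Dx (beta * e)).
move: (expR (beta * (1 - e))) (expR (beta * e)) => y z y0 z0 zge.
have -> : y * z / (y * z + y) = 1 - (z + 1)^-1.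
  have yz0 : 0 < y * z by exact: mulr_gt0.
  by field; apply/andP; split; lra.
rewrite ltrD2l ltrN2 -div1r ltr_pdivrMr ?addr_gt0//.
have : (1 + beta * e) * e <= z * e by rewrite ler_wpM2r// ltW.
by lra.
Qed.

(* With p = e / 4 in the header, mass3 is the mass of the third type of voters
   and gap3 is t. *)
Definition mass3 (R : realType) (e : R) : R := 1 - (2 - e) * (e / 4).
Definition gap3 (R : realType) (e : R) : R := e / 2 * (1 + 2 * e).

Section three_types.
Variables (R : realType) (e : R).

Lemma small_sqr_itv : 0 < e -> e <= 8^-1 -> 0 < e * e <= e / 8.
Proof. by move=> e0 e8; rewrite mulr_gt0//= ler_wpM2l// ltW. Qed.

Lemma mass3_itv : 0 < e -> e <= 8^-1 -> 0 < mass3 e <= 1.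
Proof.
move=> e0 e8; have /andP[] := small_sqr_itv e0 e8.
have -> : mass3 e = 1 - e / 2 + e * e / 4 by rewrite /mass3; field.
by move: (e * e) => s s0 s8; apply/andP; split; lra.
Qed.

Lemma gap3_itv : 0 < e -> e <= 8^-1 -> 0 < gap3 e <= 1.
Proof.
move=> e0 e8; have /andP[] := small_sqr_itv e0 e8.
have -> : gap3 e = e / 2 + e * e by rewrite /gap3; field.
by move: (e * e) => s s0 s8; apply/andP; split; lra.
Qed.

(** The third type's gain for [a] against [c] covers e / 8, half the mass of the second type. The
    factor 1 + 2 e in [gap3] provides a surplus of order e^2. *)
Lemma mass3_gap3_gt : 0 < e -> e <= 8^-1 ->
  e / 8 < mass3 e * (gap3 e / 2 / (2 + gap3 e)).
Proof.
move=> e0 e8; have /andP[g0 _] := gap3_itv e0 e8.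
have /andP[ee0 _] := small_sqr_itv e0 e8.
rewrite mulrA ltr_pdivlMr; last by lra.
have -> : mass3 e * (gap3 e / 2) =
    e / 8 * (2 + gap3 e) + e * e / 8 * (5 / 2 - 5 / 2 * e + e * e).
  by rewrite /mass3 /gap3; field.
rewrite ltrDl mulr_gt0 ?divr_gt0//.
by move: (e * e) ee0 => s s0; lra.
Qed.

(** This compares [beta] times the mean utility of [a] with the mean utility of [b]. It rests on (1
    - 4 e) (1 + 2 e) = 1 - 2 e - 8 e^2 < 1 - e. *)
Lemma mass3_gap3_lt : 0 < e -> e <= 8^-1 ->
  (1 - 4 * e) * (mass3 e * gap3 e) < (1 - e) * (e / 2).
Proof.
move=> e0 e8; have /andP[m0 m1] := mass3_itv e0 e8.
have /andP[ee0 ee8] := small_sqr_itv e0 e8.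
have -> : (1 - 4 * e) * (mass3 e * gap3 e) =
    mass3 e * ((1 - 2 * e - 8 * (e * e)) * (e / 2)) by rewrite /gap3; field.
move: (e * e) ee0 ee8 => s s0 s8.
apply: (@le_lt_trans _ _ ((1 - 2 * e - 8 * s) * (e / 2))).
  by rewrite ler_piMl// mulr_ge0//; lra.
by rewrite ltr_pM2r; lra.
Qed.

End three_types.

Lemma distortion_copeland3_ge (R : realType) (e beta : R) (tb : tiebreak 3) :
  0 < e <= 8^-1 -> 1 <= beta -> 2 / e ^+ 2 <= beta ->
  (((1 - 4 * e) * beta)%:E <= distortion beta (copeland R tb))%E.
Proof.
move=> /andP[e0 e8] beta1; rewrite ler_pdivrMr ?exprn_gt0// expr2 mulrA => be.
have [a atop] := tiebreak_top tb.
have [b [c [abc ca bc ba]]] : exists b c : 'I_3,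
    [/\ forall j, [|| j == a, j == b | j == c], c != a, b != c & b != a].
  (* Addition in ['I_3] is modulo 3. *)
  exists (a + 1), (a + 2%:R).
  by case: a {atop} => -[|[|[|//]]] ?; split => //; case=> -[|[|[|//]]].
have /andP[m0 m1] := mass3_itv e0 e8; have /andP[t0 t1] := gap3_itv e0 e8.
have beta0 : 0 < beta by exact: lt_le_trans beta1.
pose ws := [:: (1 - e) * (e / 4); e / 4; mass3 e].
have w_ge0 (k : 'I_3) : 0 <= ws`_k.
  case: k => -[|[|[|//]]] ? /=; last exact: ltW.
    by rewrite mulr_ge0//; lra.
  by lra.
have w_sum1 : \sum_(k < 3) ws`_k = 1.
  by rewrite !big_ord_recl big_ord0 /= /mass3; ring.
(* Each list runs over the three types, in the order of the masses [ws]. *)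
pose us j : seq R := if j == a then [:: 0; 0; gap3 e / beta]
  else if j == b then [:: 1; 1 - e; 0] else [:: 0; 1; 0].
pose x (k : 'I_3) : 3.-tuple R := mktuple (fun j => (us j)`_k).
have xE k j : tnth (x k) j = (us j)`_k by rewrite tnth_mktuple.
have [usa usb usc] : [/\ us a = [:: 0; 0; gap3 e / beta],
    us b = [:: 1; 1 - e; 0] & us c = [:: 0; 1; 0]].
  by rewrite /us !eqxx (negbTE ba) (negbTE ca) eq_sym (negbTE bc).
have x01 k j : 0 <= tnth (x k) j <= 1.
  have tb01 : 0 <= gap3 e / beta <= 1.
    by rewrite ltW ?divr_gt0//= ler_pdivrMr// mul1r (le_trans t1).
  have e01 : 0 <= 1 - e <= 1 by clear -e0 e8; lra.
  have := abc j; rewrite xE => /or3P[] /eqP->; rewrite ?usa ?usb ?usc;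
    by case: k => -[|[|[|//]]] ? /=; rewrite ?tb01 ?e01 ?lexx ?ler01.
have sum3 (f : nat -> R) : \sum_(k < 3) f k = f 0 + f 1 + f 2.
  by rewrite !big_ord_recr big_ord0 /= add0r.
have betat : beta * (gap3 e / beta) = gap3 e by rewrite mulrC divfK// gt_eqF.
have half : (1 : R) / (1 + 1) = 2^-1 by rewrite div1r.
have E1 : 0 < 1 / (1 + expR beta) by rewrite divr_gt0// addr_gt0 ?expR_gt0.
have E2 := logistic_gap_gt e0 be.
apply: (@distortion_copeland_ge R beta tb a b c 2 (Lottery w_ge0 w_sum1) x) => //.
(* [a] against [c]: the first type is evenly split, the second contributes a positive amount, and
   the third has the logistic bound. *)
- under eq_bigr do rewrite !xE /=.
  rewrite (sum3 (fun k => ws`_k * (expR (beta * (us a)`_k) /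
    (expR (beta * (us a)`_k) + expR (beta * (us c)`_k))))) usa usc /=.
  rewrite betat mulr0 mulr1 expR0 half.
  have := mass3_gap3_gt e0 e8.
  have : 0 < e / 4 * (1 / (1 + expR beta)) by rewrite mulr_gt0// divr_gt0.
  have := ler_wpM2l (ltW m0) (logistic_ge (ltW t0)).
  have -> : mass3 e * (2^-1 + gap3 e / 2 / (2 + gap3 e)) = 2^-1 - e / 8 -
      (1 - e) * (e / 4) * 2^-1 + mass3 e * (gap3 e / 2 / (2 + gap3 e)).
    by rewrite mulrDr {1}/mass3; congr (_ + _); field.
  clear; move: (mass3 e * _) (mass3 e * _) (e / 4 * _) ((1 - e) * _ * _).
  by move=> A B C D; lra.
(* [c] against [b]: the third type is evenly split and falls short of one half by exactly e / 4 (1 -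
   e / 2), which the second type exceeds. *)
- under eq_bigr do rewrite !xE /=.
  rewrite (sum3 (fun k => ws`_k * (expR (beta * (us c)`_k) /
    (expR (beta * (us c)`_k) + expR (beta * (us b)`_k))))) usb usc /=.
  rewrite !mulr1 mulr0 expR0 half.
  have e40 : 0 < e / 4 by rewrite divr_gt0.
  rewrite -(ltr_pM2l e40) in E2; move: E2.
  have : 0 < (1 - e) * (e / 4) * (1 / (1 + expR beta)).
    by rewrite !mulr_gt0//; clear -e8; lra.
  have -> : mass3 e * 2^-1 = 2^-1 - e / 4 * (1 - e / 2) by rewrite /mass3; field.
  clear; move: (e / 4 * (1 - _)) (_ * (1 / _)) (_ * (expR beta / _)).
  by move=> A B C; lra.
- under eq_bigr do rewrite xE /=.
  rewrite (sum3 (fun k => ws`_k * (us b)`_k)) usb /=.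
  have -> : (1 - e) * (e / 4) * 1 + e / 4 * (1 - e) + mass3 e * 0 =
      (1 - e) * (e / 2) by field.
  by rewrite mulr_gt0//; clear -e0 e8; lra.
- under eq_bigr do rewrite xE /=.
  under [X in _ < X]eq_bigr do rewrite xE /=.
  rewrite (sum3 (fun k => ws`_k * (us a)`_k)) (sum3 (fun k => ws`_k * (us b)`_k)).
  rewrite usa usb /= !mulr0 !add0r addr0 mulr1.
  have -> : (1 - 4 * e) * beta * (mass3 e * (gap3 e / beta)) =
      (1 - 4 * e) * (mass3 e * gap3 e) by field; rewrite gt_eqF.
  have -> : (1 - e) * (e / 4) + e / 4 * (1 - e) = (1 - e) * (e / 2) by field.
  exact: mass3_gap3_lt.
Qed.

(* The supremum over m of the distortion with m.+2 candidates is the supremum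
   over all numbers of candidates >= 2. *)
Theorem theorem6p4 (R : realType) (eps : R) (eps_gt0 : 0 < eps) :
  exists beta0 : R, forall beta : R, 1 <= beta -> beta0 <= beta ->
    forall tb : (forall m : nat, tiebreak m),
      (((1 - eps) * beta)%:E <=
         ereal_sup [set distortion beta (copeland R (tb m.+2)) | m in [set: nat]])%E.
Proof.
(* The loss factor is 1 - 4 e, and the estimates assume e <= 1/8. *)
pose e := Num.min (eps / 4) 8^-1.
have e01 : 0 < e <= 8^-1 by rewrite lt_min ge_min lexx orbT andbT; lra.
have e_eps : 4 * e <= eps.
  have : e <= eps / 4 by rewrite ge_min lexx.
  lra.
exists (2 / e ^+ 2) => beta beta1 beta_ge tb.
apply: le_trans (_ : (((1 - 4 * e) * beta)%:E <= _)%E).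
  by rewrite lee_fin ler_wpM2r//; lra.
apply: le_trans (distortion_copeland3_ge (tb 3) e01 beta1 beta_ge) _.
(* Index 1 stands for three candidates. *)
by apply: ereal_sup_ubound; exists 1%N.
Qed.
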